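(* Let $x(t)=x^{(N)}(t)$ be the Markov process with generator $L=L_0+L_s$ defined in the context, and let $R_N(t):=\mathsf E\,V(x(t))$. Assume $\sup_N |R_N(0)|<\infty$, and let $t(N)\to\infty$ as $N\to\infty$. Put $\varkappa=\sum_{j=1}^l k_j^2-k$. Then, as $N\to\infty$ (with $f\sim g$ meaning $f/g\to1$): (i) if $t(N)/N^2\to0$, then $R_N(t(N))\sim\alpha b_2\,t(N)$; (ii) if $t(N)=cN^2$ for a constant $c>0$, then $R_N(t(N))\sim\alpha b_2(\delta\varkappa)^{-1}\big(1-e^{-\delta\varkappa c}\big)N^2$; (iii) if $t(N)/N^2\to\infty$, then $R_N(t(N))\sim\alpha b_2(\delta\varkappa)^{-1}N^2$.
   Context: Fix an integer $k\ge2$ and integers $k_1,\dots,k_l\ge2$ with $k_1+\dots+k_l=k$ (fixed independently of $N$). For $N\ge k$, let $\mathcal I$ be the set of ordered $k$-tuples $(i_1,\dots,i_k)$ of pairwise distinct elements of $\{1,\dots,N\}$. For $(i_1,\dots,i_k)\in\mathcal I$ split it into consecutive blocks $\Gamma_1,\dots,\Gamma_l$ of lengths $k_1,\dots,k_l$ and let $g_j$ be the first element of $\Gamma_j$. The synchronization map $J^{(i_1,\dots,i_k)}:\mathbb{R}^N\to\mathbb{R}^N$, $x\mapsto y$, is $y_m=x_m$ if $m\notin\{i_1,\dots,i_k\}$ and $y_m=x_{g_j}$ if $m\in\Gamma_j$. Let $\alpha>0,\delta>0$ (independent of $N$), and let $\rho$ be a probability measure on $\mathbb{R}$ with compact support and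 $b_2:=\int z^2\rho(dz)>0$. The process $x(t)=(x_1(t),\dots,x_N(t))\in\mathbb{R}^N$ is the continuous-time Markov jump process with generator $L=L_0+L_s$, $(L_0f)(x)=\alpha\sum_{i=1}^N\int\big(f(x+ze_i)-f(x)\big)\rho(dz)$, $(L_sf)(x)=\frac{\delta}{N(N-1)\cdots(N-k+1)}\sum_{(i_1,\dots,i_k)\in\mathcal I}\big(f(J^{(i_1,\dots,i_k)}x)-f(x)\big)$: each particle independently jumps $x_i\to x_i+z$, $z\sim\rho$, at rate $\alpha$, and independently at rate $\delta$ a uniformly random tuple of $\mathcal I$ is chosen and the configuration is replaced by $J^{(i_1,\dots,i_k)}x$. The initial configuration $x(0)$ may be random. $V(x)=\frac{1}{N(N-1)}\sum_{1\le m<n\le N}(x_m-x_n)^2$ (the empirical variance). *)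

(* Defs.v *)
From HB Require Import structures.
From mathcomp Require Import all_boot all_order all_algebra.
From mathcomp Require Import all_classical all_reals all_analysis.
Set Implicit Arguments. Unset Strict Implicit. Unset Printing Implicit Defensive.
Import Order.TTheory GRing.Theory Num.Theory.
Import numFieldNormedType.Exports.
Local Open Scope classical_set_scope.
Local Open Scope ring_scope.
Local Open Scope ereal_scope.

Definition shift (R : realType) (N : nat) (x : 'I_N -> R) (i : 'I_N) (z : R)
  : 'I_N -> R := fun m => if m == i then (x m + z)%R else x m.

(* for block lengths ks = [:: k_1; ...; k_l], position p (0-based) in
   {0,..,k-1}: the position of the first element of the block containing p *)
Fixpoint blockstart (ks : seq nat) (p : nat) : nat :=
  match ks with
  | [::] => p
  | a :: ks' => if (p < a)%N then 0%N else (a + blockstart ks' (p - a))%N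
  end.

Definition sync (R : realType) (N k : nat) (ks : seq nat)
  (u : {ffun 'I_k -> 'I_N}) (x : 'I_N -> R) : 'I_N -> R :=
  fun m => match [pick p : 'I_k | u p == m] with
           | Some p => x (nth m (map u (enum 'I_k)) (blockstart ks p))
           | None => x m
           end.

Definition jrate (R : realType) (alpha delta : R) (N : nat) : R :=
  (alpha * N%:R + delta)%R.

(* Markov kernel K = I + L / lambda of the embedded (uniformized) jump chain,
   acting on nonnegative functions *)
Definition jump_kernel (R : realType) (rho : probability R R) (alpha delta : R)
  (k : nat) (ks : seq nat) (N : nat) (f : ('I_N -> R) -> \bar R)
  : ('I_N -> R) -> \bar R :=
  fun x =>
    ((alpha / jrate alpha delta N)%R)%:E *
      (\sum_(i < N) \int[rho]_z f (shift x i z))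
  + ((delta / jrate alpha delta N / (N ^_ k)%:R)%R)%:E *
      (\sum_(u : {ffun 'I_k -> 'I_N} | injectiveb u) f (sync ks u x)).

(* Transition semigroup P_t f (x) = E_x f(x(t)) = sum_n Poisson(lambda t)(n) K^n f (x) *)
Definition semigroup (R : realType) (rho : probability R R) (alpha delta : R)
  (k : nat) (ks : seq nat) (N : nat) (t : R) (f : ('I_N -> R) -> \bar R)
  (x : 'I_N -> R) : \bar R :=
  \sum_(0 <= n <oo)
    ((expR (- (jrate alpha delta N * t)) * (jrate alpha delta N * t) ^+ n
       / (n`!)%:R)%R)%:E * iter n (@jump_kernel R rho alpha delta k ks N) f x.

Definition emp_var (R : realType) (N : nat) (x : 'I_N -> R) : R :=
  ((\sum_(m < N) \sum_(n < N | (m < n)%N) (x m - x n) ^+ 2)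
     / (N * (N - 1))%:R)%R.

(* R_N(t) = E V(x(t)), where x(0) = (X N i)_i on the probability space (Omega, P) *)
Definition RN (R : realType) (rho : probability R R) (alpha delta : R)
  (k : nat) (ks : seq nat) (d : measure_display) (Omega : measurableType d)
  (P : probability Omega R) (X : forall N : nat, 'I_N -> Omega -> R)
  (N : nat) (t : R) : \bar R :=
  \int[P]_w @semigroup R rho alpha delta k ks N t (fun x => (emp_var x)%:E)
                      (fun i => X N i w).

Definition moment2 (R : realType) (rho : probability R R) : R :=
  fine (\int[rho]_z ((z ^+ 2)%:E)).

(* Main.v *)
(** The empirical variance V satisfies L V = alpha b_2 - theta V with
    theta = delta kappa / (N (N - 1)): in L_0 V the terms linear in the jump
    cancel, and averaging a synchronization over all relabellings of the
    particles multiplies V by the proportion of ordered pairs of distinct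
    particles that keep distinct sources.  So R_N solves a linear ODE,
    R_N(t) = e^(-theta t) R_N(0) + alpha b_2 (1 - e^(-theta t)) / theta,
    and the three regimes are theta t -> 0, theta t -> delta kappa c and
    theta t -> +oo.  For the semigroup, a Poisson mixture of powers of the
    jump kernel K, the ODE is replaced by
    K V - V_oo = (1 - theta / lambda) (V - V_oo), V_oo = alpha b_2 / theta. *)
Require Import Defs.
From HB Require Import structures.
From mathcomp Require Import all_boot all_order all_algebra all_fingroup.
From mathcomp Require Import all_classical all_reals all_analysis.
From mathcomp Require Import measurable_realfun zify ring lra.
Set Implicit Arguments.
Unset Strict Implicit.
Unset Printing Implicit Defensive.
Import Order.TTheory GRing.Theory Num.Theory.
Import numFieldNormedType.Exports.
Local Open Scope classical_set_scope.
Local Open Scope ring_scope.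

(** * Pairs of indices identified by a map *)

Definition separated_pairs (I : finType) (T : eqType) (f : I -> T) : nat :=
  (\sum_i \sum_j (f i != f j))%N.

Definition collisions (I : finType) (T : eqType) (f : I -> T) : nat :=
  (\sum_i \sum_j ((i != j) && (f i == f j)))%N.

Lemma sum_neq (T : finType) (a : T) : (\sum_b (a != b) = #|T|.-1)%N.
Proof.
rewrite -(cardC1 a) -sum1_card [RHS]big_mkcond; apply: eq_bigr => b _.
by rewrite inE eq_sym; case: eqP.
Qed.

Lemma separated_pairs_id (T : finType) :
  separated_pairs (@id T) = (#|T| * #|T|.-1)%N.
Proof.
by rewrite /separated_pairs (eq_bigr _ (fun a _ => sum_neq a)) sum_nat_const.
Qed.

Lemma separated_pairsD (I : finType) (T : eqType) (f : I -> T) :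
  (separated_pairs f + collisions f = #|I| * #|I|.-1)%N.
Proof.
rewrite -separated_pairs_id -big_split; apply: eq_bigr => i _.
rewrite -big_split; apply: eq_bigr => j _ /=.
by have [->|_] := eqVneq i j; [rewrite eqxx | case: eqP].
Qed.

Lemma card_collisions (I : finType) (T : eqType) (f : I -> T) :
  collisions f = #|[pred p : I * I | (p.1 != p.2) && (f p.1 == f p.2)]|.
Proof.
rewrite -sum1_card [RHS]big_mkcond /collisions pair_bigA /=.
by apply: eq_bigr => p _; rewrite inE; case: andb.
Qed.

Lemma collisions_extension (I J : finType) (u : I -> J) (f : I -> I)
    (h : J -> J) :
  injective u -> (forall i, h (u i) = u (f i)) ->
  (forall j, j \notin codom u -> h j = j) ->
  collisions h = collisions f.
Proof.
move=> u_inj hu h_id; pose uu (p : I * I) := (u p.1, u p.2).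
have uu_inj : injective uu.
  by move=> [i j] [i' j'] [/u_inj -> /u_inj ->].
have moved j j' : h j = h j' -> j != j' -> j \in codom u.
  move=> hjj' jj'; apply: contraLR jj' => /[dup] ju /h_id hj; rewrite negbK.
  have [/codomP[i ji]|/h_id hj'] := boolP (j' \in codom u).
    by move: ju; rewrite -hj hjj' ji hu codom_f.
  by rewrite -hj hjj' hj'.
rewrite !card_collisions -(fintype.card_image uu_inj).
apply: eq_card => -[j j']; apply/andP/fintype.imageP => /=.
- move=> [jj' /eqP hjj']; have /codomP[i ji] := moved _ _ hjj' jj'.
  have /codomP[i' ji'] : j' \in codom u.
    by apply: moved (esym hjj') _; rewrite eq_sym.
  exists (i, i'); last by rewrite /uu ji ji'.
  move: jj' hjj'; rewrite inE /= ji ji' !hu (inj_eq u_inj) => -> /u_inj ->.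
  by rewrite eqxx.
- move=> [[i i'] /andP[/= ii' /eqP fii'] [-> ->]].
  by rewrite (inj_eq u_inj) !hu fii'.
Qed.

Section RelabellingAverage.
Variables (T : finType) (V : nmodType) (g : T -> T -> V).
Hypothesis g_diag : forall a, g a a = 0.

Lemma exists_perm_pair (a b c d : T) : a != b -> c != d ->
  exists s : {perm T}, s a = c /\ s b = d.
Proof.
move=> ab cd; exists (tperm a c * tperm (tperm a c b) d)%g.
rewrite !permM tpermL; split; last by rewrite tpermL.
rewrite tpermD //; last by rewrite eq_sym.
by rewrite -{2}(tpermL a c) (inj_eq perm_inj) eq_sym.
Qed.

Lemma sum_perm_pair (a b c d : T) :
  (\sum_(s : {perm T}) g (s a) (s b)) *+ (c != d) =
  (\sum_(s : {perm T}) g (s c) (s d)) *+ (a != b).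
Proof.
have sum_diag e : \sum_(s : {perm T}) g (s e) (s e) = 0.
  by rewrite big1 // => s _; exact: g_diag.
have [<-|ab] := eqVneq a b; first by rewrite sum_diag mul0rn.
have [<-|cd] := eqVneq c d; first by rewrite sum_diag mul0rn.
have [r [<- <-]] := exists_perm_pair ab cd.
rewrite (reindex_inj (mulgI r)); congr (_ *+ _).
by apply: eq_bigr => s _; rewrite !permM.
Qed.

(* For a != b the sum over s of g (s a) (s b) does not depend on (a, b): it is
   a constant fraction of the sum of g over all pairs. *)
Lemma sum_perm_pairs (I : finType) (f : I -> T) :
  (\sum_(s : {perm T}) \sum_i \sum_j g (s (f i)) (s (f j)))
    *+ (#|T| * #|T|.-1) =
  (\sum_a \sum_b g a b) *+ separated_pairs f *+ #|{perm T}|.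
Proof.
have sum_all_pairs : \sum_a \sum_b \sum_(s : {perm T}) g (s a) (s b) =
    (\sum_a \sum_b g a b) *+ #|{perm T}|.
  under eq_bigr do rewrite exchange_big.
  rewrite exchange_big -sumr_const; apply: eq_bigr => s _.
  rewrite [RHS](reindex_inj (@perm_inj _ s)); apply: eq_bigr => a _.
  by rewrite [RHS](reindex_inj (@perm_inj _ s)).
have average a b : (\sum_(s : {perm T}) g (s a) (s b)) *+ (#|T| * #|T|.-1) =
    (\sum_a \sum_b g a b) *+ (#|{perm T}| * (a != b)).
  rewrite [RHS]mulrnA -sum_all_pairs -separated_pairs_id -sumrMnr -sumrMnl.
  apply: eq_bigr => c _; rewrite -sumrMnr -sumrMnl.
  by apply: eq_bigr => d _; exact: sum_perm_pair.
rewrite exchange_big -sumrMnl mulrnAC -sumrMnr; apply: eq_bigr => i _.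
rewrite exchange_big -sumrMnl -sumrMnr; apply: eq_bigr => j _.
by rewrite average mulrnA.
Qed.

End RelabellingAverage.

(** * Synchronizations *)

(* kappa, counted as ordered pairs of distinct positions in a common block. *)
Definition merged_pairs (ks : seq nat) : nat :=
  sumn [seq (a * a.-1)%N | a <- ks].

Lemma natr_merged_pairs (R : pzRingType) (ks : seq nat) :
  (merged_pairs ks)%:R =
  (sumn (map (fun a => (a ^ 2)%N) ks))%:R - (sumn ks)%:R :> R.
Proof.
apply/eqP; rewrite eq_sym subr_eq -natrD; apply/eqP; congr _%:R.
rewrite /merged_pairs; elim: ks => //= a ks ->.
by rewrite addnACA -mulnn; case: a => // a; rewrite -mulnSr.
Qed.

Lemma merged_pairs_gt0 (ks : seq nat) :
  all (fun a => 2 <= a)%N ks -> (0 < sumn ks -> 0 < merged_pairs ks)%N.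
Proof. by case: ks => //= [[|[|a]] ks]. Qed.

Lemma collisions_blockstart (ks : seq nat) :
  collisions (fun p : 'I_(sumn ks) => blockstart ks p) = merged_pairs ks.
Proof.
rewrite /collisions /merged_pairs; elim: ks => [|a ks IH] /=.
  by rewrite big_ord0.
have addn_neq0 (i j : nat) : (i < a)%N -> (a + j == 0)%N = false by lia.
rewrite big_split_ord /= -IH; congr (_ + _)%N.
- rewrite -[X in (X * _)%N]card_ord -sum_nat_const; apply: eq_bigr => i _.
  rewrite big_split_ord /= ltn_ord [X in (_ + X)%N]big1 ?addn0 => [|j _].
    rewrite -[in RHS](card_ord a) -(sum_neq i); apply: eq_bigr => j _.
    by rewrite ltn_ord andbT.
  by rewrite ltnNge leq_addr /= [X in _ && X]eq_sym (addn_neq0 i) ?andbF.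
- apply: eq_bigr => i _; rewrite big_split_ord /= ltnNge leq_addr /= addKn.
  rewrite big1 ?add0n => [|j _].
    by apply: eq_bigr => j _; rewrite ltnNge leq_addr /= addKn !eqn_add2l
      (inj_eq (@rshift_inj _ _)).
  by rewrite ltn_ord (addn_neq0 j) ?andbF.
Qed.

Lemma blockstart_le (ks : seq nat) (p : nat) : (blockstart ks p <= p)%N.
Proof.
elim: ks p => [|a ks IH] p //=.
by case: ltnP => // ap; rewrite -[leqRHS](subnKC ap) leq_add2l.
Qed.

Section Synchronization.
Variables (N k : nat) (ks : seq nat).
Implicit Types (u : {ffun 'I_k -> 'I_N}) (s : 'S_N) (m : 'I_N).

Definition blockstart_ord (p : 'I_k) : 'I_k :=
  Ordinal (leq_ltn_trans (blockstart_le ks p) (ltn_ord p)).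

Definition sync_source u m : 'I_N :=
  if [pick p | u p == m] is Some p then u (blockstart_ord p) else m.

Lemma syncE (R : realType) u (x : 'I_N -> R) m :
  sync ks u x m = x (sync_source u m).
Proof.
rewrite /sync /sync_source; case: pickP => // p _; congr x.
have bs_lt : (blockstart ks p < k)%N := ltn_ord (blockstart_ord p).
rewrite (nth_map p) ?size_enum_ord //; congr (u _); apply/val_inj => /=.
by rewrite nth_enum_ord.
Qed.

Lemma sync_source_codom u p :
  injective u -> sync_source u (u p) = u (blockstart_ord p).
Proof.
move=> u_inj; rewrite /sync_source; case: pickP => [q /eqP/u_inj -> //|].
by move=> /(_ p); rewrite eqxx.
Qed.

Lemma sync_source_notin_codom u m : m \notin codom u -> sync_source u m = m.
Proof.
move=> mu; rewrite /sync_source; case: pickP => // p /eqP upm.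
by rewrite -upm codom_f in mu.
Qed.

Lemma sync_source_relabel u s m :
  sync_source [ffun p => s (u p)] (s m) = s (sync_source u m).
Proof.
rewrite /sync_source (eq_pick (_ : _ =1 (fun p => u p == m))) => [|p].
  by case: pickP => // p _; rewrite ffunE.
by rewrite /= ffunE (inj_eq perm_inj).
Qed.

Lemma sync_relabel (R : realType) u s (x : 'I_N -> R) m :
  sync ks [ffun p => s (u p)] x (s m) = sync ks u (x \o s) m.
Proof. by rewrite !syncE sync_source_relabel. Qed.

End Synchronization.

Lemma collisions_sync_source (N : nat) (ks : seq nat)
    (u : {ffun 'I_(sumn ks) -> 'I_N}) :
  injective u -> collisions (sync_source ks u) = merged_pairs ks.
Proof.
move=> u_inj; rewrite -collisions_blockstart.
apply: (collisions_extension (f := @blockstart_ord _ ks) u_inj) => [p|].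
  exact: sync_source_codom.
exact: sync_source_notin_codom.
Qed.

Lemma card_injectiveb (D T : finType) :
  #|[pred u : {ffun D -> T} | injectiveb u]| = (#|T| ^_ #|D|)%N.
Proof.
by rewrite -(cardsE [pred u : {ffun D -> T} | injectiveb u]) card_inj_ffuns.
Qed.

Lemma sum_inj_relabel (D T : finType) (V : nmodType) (s : {perm T})
    (F : {ffun D -> T} -> V) :
  \sum_(u : {ffun D -> T} | injectiveb u) F u =
  \sum_(u : {ffun D -> T} | injectiveb u) F [ffun p => s (u p)].
Proof.
rewrite (reindex (fun u : {ffun D -> T} => [ffun p => s (u p)])) /=.
  apply: eq_bigl => u; apply/injectiveP/injectiveP => u_inj p q.
    by move=> upq; apply: u_inj; rewrite !ffunE upq.
  by rewrite !ffunE => /perm_inj/u_inj.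
exists (fun u : {ffun D -> T} => [ffun p => (s^-1)%g (u p)]) => u _;
  by apply/ffunP => p; rewrite !ffunE ?permK ?permKV.
Qed.

(** * The empirical variance *)

Definition sum_sqr_diff (R : pzRingType) (I : finType) (x : I -> R) : R :=
  \sum_i \sum_j (x i - x j) ^+ 2.

Lemma sum_sqr_diff_perm (R : pzRingType) (I : finType) (s : {perm I})
    (x : I -> R) :
  sum_sqr_diff (x \o s) = sum_sqr_diff x.
Proof.
rewrite [RHS](reindex_inj (@perm_inj _ s)); apply: eq_bigr => i _.
by rewrite [RHS](reindex_inj (@perm_inj _ s)).
Qed.

Lemma sum_sqr_diffE (R : comPzRingType) (I : finType) (x : I -> R) :
  sum_sqr_diff x = 2 * (#|I|%:R * (\sum_i x i ^+ 2) - (\sum_i x i) ^+ 2).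
Proof.
transitivity (\sum_i (#|I|%:R * x i ^+ 2 - x i * (\sum_j x j) *+ 2
                      + \sum_j x j ^+ 2)).
  apply: eq_bigr => i _; under eq_bigr do rewrite sqrrB.
  rewrite big_split /= sumrB sumr_const mulr_natl; congr (_ - _ + _).
  by rewrite sumrMnl -mulr_sumr.
rewrite big_split sumrB /= -mulr_sumr sumr_const sumrMnl -mulr_suml.
by rewrite -mulr_natl; ring.
Qed.

Lemma emp_varE (R : realType) (N : nat) (x : 'I_N -> R) :
  emp_var x = sum_sqr_diff x / 2 / (N * (N - 1))%:R.
Proof.
rewrite /emp_var; congr (_ / _); set upper := \sum_m _.
suff -> : sum_sqr_diff x = upper + upper by field.
rewrite {2}/upper (exchange_big_dep xpredT) //= -big_split /=.
apply: eq_bigr => m _; rewrite (bigID (fun n : 'I_N => (m < n)%N)) /=.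
congr (_ + _); rewrite (bigD1 m) ?ltnn //= subrr expr0n add0r.
apply: eq_big => [n|n _]; last by rewrite -sqrrN opprB.
by rewrite -leqNgt andbC [RHS]ltn_neqAle.
Qed.

Lemma sum_perm_sum_sqr_diff_sync (R : realType) (N : nat) (ks : seq nat)
    (u : {ffun 'I_(sumn ks) -> 'I_N}) (x : 'I_N -> R) : injective u ->
  (\sum_(s : 'S_N) sum_sqr_diff (sync ks u (x \o s))) *+ (N * N.-1) =
  sum_sqr_diff x * ((N * N.-1)%:R - (merged_pairs ks)%:R) *+ #|'S_N|.
Proof.
move=> u_inj; pose g a b := (x a - x b) ^+ 2.
have g_diag a : g a a = 0 by rewrite /g subrr expr0n.
have separatedE : (separated_pairs (sync_source ks u))%:R =
    (N * N.-1)%:R - (merged_pairs ks)%:R :> R.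
  apply/eqP; rewrite eq_sym subr_eq -natrD -(collisions_sync_source u_inj).
  by rewrite separated_pairsD card_ord.
have := sum_perm_pairs g_diag (sync_source ks u).
rewrite card_ord -[_ *+ separated_pairs _]mulr_natr separatedE => <-.
congr (_ *+ _); apply: eq_bigr => s _; apply: eq_bigr => m _.
by apply: eq_bigr => n _; rewrite !syncE.
Qed.

Lemma sum_sqr_diff_sync (R : realType) (N : nat) (ks : seq nat)
    (x : 'I_N -> R) :
  (\sum_(u : {ffun 'I_(sumn ks) -> 'I_N} | injectiveb u)
     sum_sqr_diff (sync ks u x)) *+ (N * N.-1) =
  sum_sqr_diff x * ((N * N.-1)%:R - (merged_pairs ks)%:R) *+ (N ^_ sumn ks).
Proof.
pose sync_sum (y : 'I_N -> R) : R :=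
  \sum_(u : {ffun 'I_(sumn ks) -> 'I_N} | injectiveb u)
    sum_sqr_diff (sync ks u y).
have sync_sum_relabel (s : 'S_N) : sync_sum x = sync_sum (x \o s).
  rewrite /sync_sum (sum_inj_relabel s); apply: eq_bigr => u _.
  rewrite -(sum_sqr_diff_perm s); congr sum_sqr_diff.
  by apply/funext => m; exact: sync_relabel.
have card_perm_gt0 : (0 < #|'S_N|)%N by apply/card_gt0P; exists 1%g.
apply: (pmulrnI card_perm_gt0); rewrite -/(sync_sum x) mulrnAC -sumr_const.
under eq_bigr => s _ do rewrite (sync_sum_relabel s).
rewrite exchange_big -sumrMnl.
under eq_bigr => u /injectiveP u_inj do rewrite sum_perm_sum_sqr_diff_sync //.
by rewrite sumr_const card_injectiveb !card_ord mulrnAC.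
Qed.

Lemma natr_pairs (R : pzRingType) (N : nat) :
  (N * (N - 1))%:R = N%:R * (N%:R - 1) :> R.
Proof. by case: N => [|n]; rewrite ?mul0r // natrM subn1 -natr1 addrK. Qed.

Lemma natr_pairs_neq0 (R : numDomainType) (N : nat) :
  (1 < N)%N -> (N * (N - 1))%:R != 0 :> R.
Proof. by move=> N1; rewrite pnatr_eq0; lia. Qed.

Lemma sum_emp_var_sync (R : realType) (N : nat) (ks : seq nat)
    (x : 'I_N -> R) : (1 < N)%N ->
  \sum_(u : {ffun 'I_(sumn ks) -> 'I_N} | injectiveb u) emp_var (sync ks u x) =
  (N ^_ sumn ks)%:R * (1 - (merged_pairs ks)%:R / (N * (N - 1))%:R) * emp_var x.
Proof.
move=> /(natr_pairs_neq0 R) pairs_neq0.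
have := sum_sqr_diff_sync ks x; rewrite -subn1 -[LHS]mulr_natr => sync_eq.
under eq_bigr do rewrite emp_varE.
rewrite emp_varE -!mulr_suml -[X in X / 2](mulfK pairs_neq0) sync_eq; field.
by move: pairs_neq0; rewrite natrM mulf_eq0 negb_or andbC.
Qed.

Lemma emp_var_shift (R : realType) (N : nat) (x : 'I_N -> R) (i : 'I_N)
    (z : R) :
  emp_var (Defs.shift x i z) = emp_var x
    + (2 * (N%:R * x i - \sum_j x j) / (N * (N - 1))%:R) * z
    + ((N%:R - 1) / (N * (N - 1))%:R) * z ^+ 2.
Proof.
have sum_shift (F : R -> R) :
    \sum_j F (Defs.shift x i z j) = \sum_j F (x j) + (F (x i + z) - F (x i)).
  rewrite (bigD1 i) //= [in RHS](bigD1 i) //= /Defs.shift eqxx.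
  rewrite (eq_bigr (F \o x)) => [|j /negbTE -> //]; rewrite /=; ring.
rewrite !emp_varE !sum_sqr_diffE card_ord (sum_shift id).
rewrite (sum_shift (fun y => y ^+ 2)).
by move: ((N * (N - 1))%:R^-1 : R) => p; field.
Qed.

Lemma emp_var_ge0 (R : realType) (N : nat) (x : 'I_N -> R) : 0 <= emp_var x.
Proof.
rewrite /emp_var divr_ge0 //; apply: sumr_ge0 => m _.
by apply: sumr_ge0 => n _; exact: sqr_ge0.
Qed.

Lemma measurable_emp_var (R : realType) (d : measure_display)
    (Omega : measurableType d) (N : nat) (Y : 'I_N -> Omega -> R) :
  (forall i, measurable_fun setT (Y i)) ->
  measurable_fun setT (fun w => emp_var (fun i => Y i w)).
Proof.
move=> mY; under eq_fun do rewrite emp_varE.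
do 2!apply: measurable_funM => //; apply: measurable_sum => m.
apply: measurable_sum => n; apply: measurable_funX.
exact: measurable_funB.
Qed.

(** * The semigroup on the empirical variance *)

Lemma integrable_sqr_integrable (d : measure_display) (T : measurableType d)
    (R : realType) (mu : {finite_measure set T -> \bar R}) (f : T -> R) :
  measurable_fun setT f -> mu.-integrable setT (fun x => (f x ^+ 2)%:E) ->
  mu.-integrable setT (EFin \o f).
Proof.
move=> mf f_sqr.
have one_f_sqr : mu.-integrable setT
    ((EFin \o cst 1%R) \+ (fun x => (f x ^+ 2)%:E))%E.
  by apply: integrableD => //; exact: finite_measure_integrable_cst.
apply: (le_integrable measurableT _ _ one_f_sqr); first exact/measurable_EFinP.
move=> x _ /=; rewrite lee_fin [leRHS]ger0_norm ?addr_ge0 ?sqr_ge0 //.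
rewrite -real_normK ?num_real //.
have := sqr_ge0 (`|f x| - 1); have := normr_ge0 (f x); nra.
Qed.

Section SecondMoment.
Variables (R : realType) (rho : probability R R).

(* [fine] sends an infinite integral to 0, so positivity forces finiteness. *)
Lemma moment2_gt0_integrable : 0 < moment2 rho ->
  rho.-integrable setT (fun z : R => (z ^+ 2)%:E).
Proof.
move=> rho2_gt0; apply/integrableP; split.
  by apply/(measurable_EFinP _ (fun z : R => z ^+ 2)).
rewrite integral_fin_num_abs //.
by move: rho2_gt0; rewrite /moment2; case: integral => //=; rewrite ltxx.
Qed.

Lemma moment2_ge0 : 0 <= moment2 rho.
Proof.
by rewrite fine_ge0 // integral_ge0 // => z _; rewrite lee_fin sqr_ge0.
Qed.

Hypothesis rho_sqr : rho.-integrable setT (fun z : R => (z ^+ 2)%:E).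

Lemma integral_quadratic (a b c : R) :
  (\int[rho]_z (a + b * z + c * z ^+ 2)%:E =
   (a + b * fine (\int[rho]_z z%:E) + c * moment2 rho)%:E)%E.
Proof.
have rho_id : rho.-integrable setT (fun z : R => z%:E).
  by apply: integrable_sqr_integrable rho_sqr => //; exact: measurable_id.
have rho_cst : rho.-integrable setT (EFin \o cst a).
  exact: finite_measure_integrable_cst.
rewrite (_ : (fun z : R => _) = (((EFin \o cst a) \+ (fun z : R => b%:E * z%:E))
   \+ (fun z : R => c%:E * (z ^+ 2)%:E))%E); last by apply/funext.
rewrite integralD //=; last 2 first.
- by apply: integrableD => //; exact: integrableZl.
- exact: integrableZl.
rewrite integralD //=; last exact: integrableZl.
rewrite !integralZl // integral_cst //= probability_setT mule1.
by rewrite !EFinD !EFinM /moment2 !fineK //; exact: integrable_fin_num.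
Qed.

(* The first moment of [rho] drops out because the deviations from the
   empirical mean sum to zero. *)
Lemma sum_integral_emp_var_shift (N : nat) (a b : R) (x : 'I_N -> R) :
  (1 < N)%N ->
  (\sum_(i < N) \int[rho]_z (a * emp_var (Defs.shift x i z) + b)%:E =
   (N%:R * (a * emp_var x + b) + a * moment2 rho)%:E)%E.
Proof.
move=> N1; set first_moment := fine (\int[rho]_z z%:E)%E.
set pairs_inv : R := (N * (N - 1))%:R^-1.
have deviations0 : \sum_i (N%:R * x i - \sum_j x j) = 0.
  by rewrite sumrB -mulr_sumr sumr_const card_ord mulr_natl subrr.
have integral_shift i : (\int[rho]_z (a * emp_var (Defs.shift x i z) + b)%:E =
    (a * emp_var x + b
     + a * 2 * pairs_inv * first_moment * (N%:R * x i - \sum_j x j)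
     + a * ((N%:R - 1) * pairs_inv) * moment2 rho)%:E)%E.
  rewrite (eq_integral (fun z : R => (a * emp_var x + b
      + a * (2 * (N%:R * x i - \sum_j x j) * pairs_inv) * z
      + a * ((N%:R - 1) * pairs_inv) * z ^+ 2)%:E)).
    by rewrite integral_quadratic; congr EFin; rewrite -/first_moment; ring.
  by move=> z _; rewrite emp_var_shift; congr EFin; rewrite /pairs_inv; ring.
under eq_bigr do rewrite integral_shift.
rewrite sumEFin 2!big_split /= -mulr_sumr deviations0 !sumr_const card_ord.
have pairs_invE : N%:R * (N%:R - 1) * pairs_inv = 1.
  by rewrite -natr_pairs divff ?natr_pairs_neq0.
rewrite mulr0 addr0 -mulrnDl -[X in X%:E = _]mulr_natl; congr EFin.
rewrite -[X in _ = _ + X]mulr1 -[X in _ = _ + _ * X]pairs_invE.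
by ring.
Qed.

End SecondMoment.

Lemma sum_affine_emp_var_sync (R : realType) (N : nat) (ks : seq nat)
    (a b : R) (x : 'I_N -> R) : (1 < N)%N ->
  \sum_(u : {ffun 'I_(sumn ks) -> 'I_N} | injectiveb u)
    (a * emp_var (sync ks u x) + b) =
  (N ^_ sumn ks)%:R *
    (a * (1 - (merged_pairs ks)%:R / (N * (N - 1))%:R) * emp_var x + b).
Proof.
move=> N1; rewrite big_split /= -mulr_sumr sum_emp_var_sync // sumr_const.
by rewrite card_injectiveb !card_ord -mulr_natl; ring.
Qed.

Definition relax_rate (R : realType) (delta : R) (ks : seq nat) (N : nat) : R :=
  delta * (merged_pairs ks)%:R / (N * (N - 1))%:R.

Lemma relax_rate_gt0 (R : realType) (delta : R) (ks : seq nat) (N : nat) :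
  0 < delta -> (0 < merged_pairs ks)%N -> (1 < N)%N ->
  0 < relax_rate delta ks N.
Proof.
by move=> delta_gt0 M0 N1; rewrite divr_gt0 ?mulr_gt0 ?ltr0n //; lia.
Qed.

(* The solution at time t of y' = a - theta y started at y. *)
Definition relax (R : realType) (theta a t y : R) : R :=
  expR (- (theta * t)) * y + a / theta * (1 - expR (- (theta * t))).

Lemma relax0 (R : realType) (theta a y : R) : relax theta a 0 y = y.
Proof. by rewrite /relax mulr0 oppr0 expR0 subrr mulr0 addr0 mul1r. Qed.

Lemma poisson_geometric_series (R : realType) (s q a b : R) :
  (\sum_(0 <= n <oo)
     (expR (- s) * s ^+ n / n`!%:R)%:E * (q ^+ n * a + b)%:E =
   (expR (- ((1 - q) * s)) * a + b)%:E)%E.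
Proof.
have exp_series (z : R) :
    (fun n => \sum_(0 <= i < n) z ^+ i / i`!%:R) @ \oo --> expR z.
  exact: is_cvg_series_exp_coeff.
pose partial_sum n : R :=
  expR (- s) * a * (\sum_(0 <= i < n) (q * s) ^+ i / i`!%:R)
  + expR (- s) * b * (\sum_(0 <= i < n) s ^+ i / i`!%:R).
rewrite (_ : (fun n => _) = EFin \o partial_sum); last first.
  apply/funext => n; rewrite /= /partial_sum !mulr_sumr -big_split -sumEFin.
  by apply: eq_bigr => i _; rewrite -EFinM /= exprMn; congr EFin; ring.
rewrite (_ : _ * a + b = expR (- s) * a * expR (q * s)
    + expR (- s) * b * expR s); last first.
  rewrite mulrAC -expRD [_ * b * _]mulrAC -expRD addNr expR0 mul1r.
  by congr (expR _ * _ + _); ring.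
apply: cvg_lim => //; apply: cvg_EFin; first exact: nearW.
by apply: cvgD; apply: cvgMl_tmp; exact: exp_series.
Qed.

Section MeanEmpiricalVariance.
Variables (R : realType) (rho : probability R R) (alpha delta : R).
Variables (ks : seq nat) (N : nat).
Hypothesis rho_sqr : rho.-integrable setT (fun z : R => (z ^+ 2)%:E).
Hypotheses (alpha_ge0 : 0 <= alpha) (delta_gt0 : 0 < delta).
Hypothesis merged_gt0 : (0 < merged_pairs ks)%N.
Hypotheses (N_gt1 : (1 < N)%N) (ksN : (sumn ks <= N)%N).

Let lambda := jrate alpha delta N.
Let theta := relax_rate delta ks N.
Let theta_gt0 : 0 < theta := relax_rate_gt0 delta_gt0 merged_gt0 N_gt1.
Let limit_var := alpha * moment2 rho / theta.

Lemma jrate_gt0 : 0 < jrate alpha delta N.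
Proof. by rewrite ltr_wpDl // mulr_ge0. Qed.

Lemma jump_kernel_emp_var (a : R) (x : 'I_N -> R) :
  jump_kernel rho alpha delta (sumn ks) ks
    (fun y => (a * (emp_var y - limit_var) + limit_var)%:E) x =
  (a * (1 - theta / lambda) * (emp_var x - limit_var) + limit_var)%:E.
Proof.
pose b := limit_var - a * limit_var.
have affineE y : a * (emp_var y - limit_var) + limit_var = a * emp_var y + b.
  by rewrite /b; ring.
rewrite /jump_kernel.
under eq_bigr => i _ do under eq_integral do rewrite affineE.
rewrite sum_integral_emp_var_shift //; under eq_bigr do rewrite affineE.
rewrite sumEFin sum_affine_emp_var_sync // -!EFinM -EFinD; congr EFin.
have theta_neq0 := lt0r_neq0 theta_gt0.
have lambda_neq0 : lambda != 0 := lt0r_neq0 jrate_gt0.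
have injections_neq0 : (N ^_ sumn ks)%:R != 0 :> R.
  by rewrite pnatr_eq0 -lt0n ffact_gt0.
have inputE : alpha * moment2 rho = limit_var * theta by rewrite divfK.
have lossE : (merged_pairs ks)%:R / (N * (N - 1))%:R = theta / delta.
  by rewrite [RHS]mulrC !mulrA mulVf ?mul1r ?lt0r_neq0.
have jumpsE : alpha * N%:R = lambda - delta by rewrite addrK.
transitivity (alpha * N%:R / lambda * (a * emp_var x + b)
    + a * (alpha * moment2 rho) / lambda
    + delta / lambda * (a * (1 - theta / delta) * emp_var x + b)).
  rewrite lossE -/lambda; field.
  by rewrite injections_neq0 lambda_neq0 lt0r_neq0.
by rewrite jumpsE inputE /b; field; rewrite lambda_neq0 lt0r_neq0.
Qed.

Lemma iter_jump_kernel_emp_var (n : nat) (x : 'I_N -> R) :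
  iter n (@jump_kernel R rho alpha delta (sumn ks) ks N)
    (fun y => (emp_var y)%:E) x =
  ((1 - theta / lambda) ^+ n * (emp_var x - limit_var) + limit_var)%:E.
Proof.
elim: n x => [|n IH] x /=; first by rewrite mul1r subrK.
by rewrite (funext IH) jump_kernel_emp_var exprSr.
Qed.

Lemma semigroup_emp_var (t : R) (x : 'I_N -> R) :
  semigroup rho alpha delta (sumn ks) ks t (fun y => (emp_var y)%:E) x =
  (relax theta (alpha * moment2 rho) t (emp_var x))%:E.
Proof.
rewrite /semigroup; under eq_eseriesr do rewrite iter_jump_kernel_emp_var.
rewrite poisson_geometric_series; congr EFin.
rewrite subKr -/lambda mulrA divfK ?lt0r_neq0 ?jrate_gt0 //.
by rewrite /relax -/limit_var; ring.
Qed.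

Variables (d : measure_display) (Omega : measurableType d).
Variables (P : probability Omega R) (X : forall N : nat, 'I_N -> Omega -> R).
Hypothesis mX : forall i : 'I_N, measurable_fun setT (@X N i).

Let mean_var t := RN rho alpha delta (sumn ks) ks P X N t.

Lemma RN0 : mean_var 0 = (\int[P]_w (emp_var (fun i => @X N i w))%:E)%E.
Proof. by apply: eq_integral => w _; rewrite semigroup_emp_var relax0. Qed.

Lemma RN_relax (t : R) : 0 <= t -> mean_var 0 \is a fin_num ->
  mean_var t = (relax theta (alpha * moment2 rho) t (fine (mean_var 0)))%:E.
Proof.
move=> t_ge0 fin0.
have mV : measurable_fun setT (fun w => (emp_var (fun i => @X N i w))%:E).
  by apply/measurable_EFinP; exact: measurable_emp_var.
have drift_ge0 : 0 <= limit_var * (1 - expR (- (theta * t))).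
  rewrite mulr_ge0 ?subr_ge0 ?expR_le1 ?oppr_le0 ?(mulr_ge0 (ltW theta_gt0)) //.
  by rewrite divr_ge0 ?mulr_ge0 ?moment2_ge0 // ltW.
rewrite /mean_var /RN.
under eq_integral do rewrite semigroup_emp_var EFinD EFinM.
rewrite ge0_integralD //=; last 2 first.
- by move=> w _; rewrite -EFinM lee_fin mulr_ge0 ?expR_ge0 ?emp_var_ge0.
- exact: measurable_funeM.
rewrite integral_cst //= probability_setT mule1.
rewrite ge0_integralZl_EFin ?expR_ge0 //.
  by rewrite -RN0 -(fineK fin0).
by move=> w _; rewrite lee_fin emp_var_ge0.
Qed.

End MeanEmpiricalVariance.

(** * Asymptotics of the relaxation *)

Section FilterLimits.
Variables (R : realType) (T : Type) (F : set_system T).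
Context {FF : Filter F}.

Lemma near_eq_cvg_to (U : Type) (G : set_system U) (f h : T -> U) :
  (\forall n \near F, f n = h n) -> f @ F --> G -> h @ F --> G.
Proof. by move=> fh; apply: cvg_trans; exact: near_eq_cvg. Qed.

Lemma cvg_bounded_div (f g : T -> R) (C : R) :
  (\forall n \near F, `|f n| <= C) -> g @ F --> +oo ->
  (fun n => f n / g n) @ F --> (0 : R).
Proof.
move=> f_le g_y; have g_gt0 : \forall n \near F, 0 < g n by exact: cvgry_gt.
have Cg : (fun n => C * (g n)^-1) @ F --> (0 : R).
  by rewrite -[X in _ --> X](mulr0 C); apply: cvgMl_tmp; apply/gtr0_cvgV0.
have NCg : (fun n => - (C * (g n)^-1)) @ F --> (0 : R).
  by rewrite -[X in _ --> X]oppr0; exact: cvgN.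
apply: (squeeze_cvgr _ NCg Cg); near=> n.
have gn : 0 < g n by near: n.
rewrite -ler_norml normrM [`|(g n)^-1|]gtr0_norm ?invr_gt0 //.
by rewrite ler_pM2r ?invr_gt0 //; near: n.
Unshelve. all: by end_near.
Qed.

Lemma cvg_one_sub_expRN_div (s : T -> R) :
  (\forall n \near F, 0 < s n) -> s @ F --> (0 : R) ->
  (fun n => (1 - expR (- s n)) / s n) @ F --> (1 : R).
Proof.
move=> s_gt0 s_0.
have inv1s : (fun n => (1 + s n)^-1) @ F --> (1 : R).
  rewrite -[X in _ --> X]invr1; apply: cvgV => //.
  by rewrite -[X in _ --> X]addr0; apply: cvgD => //; exact: cvg_cst.
apply: (squeeze_cvgr _ inv1s (@cvg_cst _ _ _ _ _)); near=> n.
have sn : 0 < s n by near: n.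
have sn1 : 0 < 1 + s n by rewrite addr_gt0.
apply/andP; split; last first.
  by rewrite ler_pdivrMr // mul1r lerBlDr addrC -lerBlDr expR_ge1Dx.
rewrite ler_pdivlMr // (_ : _^-1 * _ = 1 - (1 + s n)^-1).
  by rewrite lerD2l lerN2 expRN lef_pV2 ?posrE ?expR_gt0 // expR_ge1Dx.
by field; rewrite lt0r_neq0.
Unshelve. all: by end_near.
Qed.

Lemma cvgy_scale (a : R) (f : T -> R) : 0 < a ->
  f @ F --> +oo -> (fun n => a * f n) @ F --> +oo.
Proof. by move=> a_gt0 f_y; exact: (@gt0_cvgMry _ (f @ F) _ a id). Qed.

Lemma cvg_fine_div (f : T -> \bar R) (h g : T -> R) (l : R) :
  (\forall n \near F, f n = (h n)%:E) -> (fun n => h n / g n) @ F --> l ->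
  (\forall n \near F, f n \is a fin_num) /\
  (fun n => fine (f n) / g n) @ F --> l.
Proof.
move=> fE hg; split; first by apply: filterS fE => n ->.
by apply: near_eq_cvg_to hg; apply: filterS fE => n ->.
Qed.

End FilterLimits.

(* The rate theta is of order 1 / g, so time is measured in units of g. *)
Section RelaxAsymptotics.
Variables (R : realType) (T : Type) (F : set_system T).
Context {FF : Filter F}.
Variables (theta t r g : T -> R) (a C D : R).
Hypotheses (a_gt0 : 0 < a) (D_gt0 : 0 < D).
Hypothesis theta_gt0 : \forall n \near F, 0 < theta n.
Hypothesis r_le : \forall n \near F, `|r n| <= C.
Hypotheses (t_y : t @ F --> +oo) (g_y : g @ F --> +oo).
Hypothesis theta_g : (fun n => theta n * g n) @ F --> D.

Let t_gt0 : \forall n \near F, 0 < t n := cvgry_gt t_y 0.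
Let g_gt0 : \forall n \near F, 0 < g n := cvgry_gt g_y 0.

Lemma near_rate_mul_timeE :
  \forall n \near F, (theta n * g n) * (t n / g n) = theta n * t n.
Proof. by apply: filterS g_gt0 => n gn; field; exact: lt0r_neq0. Qed.

Lemma cvg_rate_mul_time (c : R) : (fun n => t n / g n) @ F --> c ->
  (fun n => theta n * t n) @ F --> D * c.
Proof.
by move=> t_c; apply: near_eq_cvg_to near_rate_mul_timeE (cvgM theta_g t_c).
Qed.

Lemma cvgy_rate_mul_time : (fun n => t n / g n) @ F --> +oo ->
  (fun n => theta n * t n) @ F --> +oo.
Proof.
move=> tg_y; have halfD_gt0 : 0 < D / 2 by rewrite divr_gt0.
have halfD_lt : D / 2 < D by rewrite ltr_pdivrMr // ltr_pMr // ltr1n.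
have theta_g_gt : \forall n \near F, D / 2 < theta n * g n.
  exact: cvgr_gt theta_g _ halfD_lt.
apply: ger_cvgy (cvgy_scale halfD_gt0 tg_y); near=> n.
have <- : theta n * g n * (t n / g n) = theta n * t n.
  by near: n; exact: near_rate_mul_timeE.
have tg_gt0 : 0 < t n / g n by rewrite divr_gt0 //; near: n.
by rewrite (ler_wpM2r (ltW tg_gt0)) // ltW //; near: n.
Unshelve. all: by end_near.
Qed.

Lemma cvg_expRN_bounded_div (h : T -> R) : h @ F --> +oo ->
  (fun n => expR (- (theta n * t n)) * r n / h n) @ F --> (0 : R).
Proof.
move=> h_y; apply: (cvg_bounded_div (C := C) _ h_y); near=> n.
have exponent_gt0 : 0 < theta n * t n by rewrite mulr_gt0 //; near: n.
rewrite normrM ger0_norm ?expR_ge0 //.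
apply: (@le_trans _ _ `|r n|); last by near: n.
by rewrite ler_piMl // expR_le1 oppr_le0 ltW.
Unshelve. all: by end_near.
Qed.

Lemma cvg_relax_short : (fun n => t n / g n) @ F --> (0 : R) ->
  (fun n => relax (theta n) a (t n) (r n) / (a * t n)) @ F --> (1 : R).
Proof.
move=> /cvg_rate_mul_time; rewrite mulr0 => exponent0.
have exponent_gt0 : \forall n \near F, 0 < theta n * t n.
  by apply: filterS2 theta_gt0 t_gt0 => n; exact: mulr_gt0.
rewrite -[X in _ --> X]add0r.
apply: near_eq_cvg_to (cvgD (cvg_expRN_bounded_div (cvgy_scale a_gt0 t_y))
  (cvg_one_sub_expRN_div exponent_gt0 exponent0)).
apply: filterS2 theta_gt0 t_gt0 => n thetan tn; rewrite /relax !fctE /=.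
by move: (expR _) => e; field; rewrite !lt0r_neq0.
Qed.

Lemma cvg_relax_long (l : R) : 0 < l ->
  (fun n => 1 - expR (- (theta n * t n))) @ F --> l ->
  (fun n => relax (theta n) a (t n) (r n) / (a / D * l * g n)) @ F --> (1 : R).
Proof.
move=> l_gt0 decayed.
have scale_gt0 : 0 < a / D * l by rewrite mulr_gt0 ?divr_gt0.
have -> : (1 : R) = 0 + D^-1 * l * (D / l) by field; rewrite !lt0r_neq0.
apply: near_eq_cvg_to (cvgD (cvg_expRN_bounded_div (cvgy_scale scale_gt0 g_y))
  (cvgM (cvgM (cvgV (lt0r_neq0 D_gt0) theta_g) decayed) (cvg_cst (D / l)))).
apply: filterS2 theta_gt0 g_gt0 => n thetan gn; rewrite /relax !fctE /=.
by move: (expR _) => e; field; rewrite !lt0r_neq0.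
Qed.

Lemma cvg_relax_moderate (c : R) : 0 < c -> (fun n => t n / g n) @ F --> c ->
  (fun n => relax (theta n) a (t n) (r n) /
     (a / D * (1 - expR (- (D * c))) * g n)) @ F --> (1 : R).
Proof.
move=> c_gt0 /cvg_rate_mul_time exponentDc; apply: cvg_relax_long.
  by rewrite subr_gt0 expR_lt1 oppr_lt0 mulr_gt0.
apply: cvgB; first exact: cvg_cst.
exact: (cvg_comp _ _ (cvgN exponentDc) (@continuous_expR R _)).
Qed.

Lemma cvg_relax_equilibrium : (fun n => t n / g n) @ F --> +oo ->
  (fun n => relax (theta n) a (t n) (r n) / (a / D * g n)) @ F --> (1 : R).
Proof.
move=> /cvgy_rate_mul_time exponent_y; rewrite -[a / D]mulr1.
apply: cvg_relax_long => //.
rewrite -[X in _ --> X]subr0; apply: cvgB; first exact: cvg_cst.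
exact: (cvg_comp _ _ exponent_y (@cvgr_expR R)).
Qed.

End RelaxAsymptotics.

Lemma cvg_relax_rate_sqr (R : realType) (delta : R) (ks : seq nat) :
  (fun N => relax_rate delta ks N * N%:R ^+ 2) @ \oo -->
  delta * (merged_pairs ks)%:R.
Proof.
have one_sub_inv : (fun N => 1 - (N%:R : R)^-1) @ \oo --> (1 : R).
  rewrite -[X in _ --> X]subr0; apply: cvgB; first exact: cvg_cst.
  apply/gtr0_cvgV0; last exact: cvgr_idn.
  by exists 1%N => // N /= N1; rewrite ltr0n.
rewrite -[X in _ --> X]mulr1 -[X in _ * X]invr1.
apply: near_eq_cvg_to (cvgMl_tmp (cvgV (oner_neq0 R) one_sub_inv)).
exists 2%N => // N /= /(natr_pairs_neq0 R).
rewrite /relax_rate natr_pairs mulf_eq0 negb_or => /andP[N_neq0 N1_neq0].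
by field; rewrite N_neq0 N1_neq0.
Qed.

Lemma cvg_sqr_natr (R : realType) : (fun N => N%:R ^+ 2 : R) @ \oo --> +oo.
Proof. exact: (cvg_comp _ _ cvgr_idn cvgr_expr2). Qed.

Lemma abse_le_fine (R : realDomainType) (x : \bar R) (C : R) :
  (`|x| <= C%:E)%E -> x \is a fin_num /\ `|fine x| <= C.
Proof. by case: x => [r| |] //=; rewrite lee_fin. Qed.

Section MeanAsymptotics.
Variables (R : realType) (rho : probability R R) (alpha delta : R).
Variables (ks : seq nat) (d : measure_display) (Omega : measurableType d).
Variables (P : probability Omega R) (X : forall N : nat, 'I_N -> Omega -> R).
Hypothesis rho_sqr : rho.-integrable setT (fun z : R => (z ^+ 2)%:E).
Hypotheses (alpha_ge0 : 0 <= alpha) (delta_gt0 : 0 < delta).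
Hypothesis merged_gt0 : (0 < merged_pairs ks)%N.
Hypothesis mX : forall N (i : 'I_N), measurable_fun setT (@X N i).

Let mean_var N t := RN rho alpha delta (sumn ks) ks P X N t.

Variable C : R.
Hypothesis mean_var0_le :
  forall N, (sumn ks <= N)%N -> (`| mean_var N 0 | <= C%:E)%E.

Lemma near_RN0_le : \forall N \near \oo, `|fine (mean_var N 0)| <= C.
Proof. by exists (sumn ks) => // N /= /mean_var0_le /abse_le_fine[]. Qed.

Lemma near_RN_relax (t : nat -> R) : t @ \oo --> +oo ->
  \forall N \near \oo, mean_var N (t N) =
    (relax (relax_rate delta ks N) (alpha * moment2 rho) (t N)
       (fine (mean_var N 0)))%:E.
Proof.
move=> t_y; near=> N; have ksN : (sumn ks <= N)%N.
  by near: N; exact: nbhs_infty_ge.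
apply: RN_relax => //; first by near: N; exact: nbhs_infty_gt.
  by near: N; exact: cvgry_ge.
by have [] := abse_le_fine (mean_var0_le ksN).
Unshelve. all: by end_near.
Qed.

End MeanAsymptotics.

Theorem theorem2 (R : realType) (k : nat) (ks : seq nat)
  (alpha delta : R) (rho : probability R R)
  (d : measure_display) (Omega : measurableType d) (P : probability Omega R)
  (X : forall N : nat, 'I_N -> Omega -> R) (t : nat -> R) :
  (2 <= k)%N -> all (fun a => 2 <= a)%N ks -> sumn ks = k ->
  0 < alpha -> 0 < delta ->
  (exists M : R, rho [set z : R | M < `|z|] = 0%E) ->
  0 < moment2 rho ->
  (forall N (i : 'I_N), measurable_fun setT (X N i)) ->
  (exists C : R, forall N, (k <= N)%N ->
     (`| RN rho alpha delta k ks P X N 0 | <= C%:E)%E) ->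
  t @ \oo --> +oo ->
  let kappa : R := ((sumn (map (fun a => (a ^ 2)%N) ks))%:R - k%:R) in
  let RNt := fun N => RN rho alpha delta k ks P X N (t N) in
  (* (i) *)
  ((fun N => t N / (N%:R ^+ 2)) @ \oo --> 0 ->
     (\forall N \near \oo, RNt N \is a fin_num) /\
     (fun N => fine (RNt N) / (alpha * moment2 rho * t N)) @ \oo --> (1:R))
  /\
  (* (ii) *)
  (forall c : R, 0 < c -> (forall N, t N = c * N%:R ^+ 2) ->
     (\forall N \near \oo, RNt N \is a fin_num) /\
     (fun N => fine (RNt N) /
        (alpha * moment2 rho / (delta * kappa)
         * (1 - expR (- (delta * kappa * c))) * N%:R ^+ 2)) @ \oo --> (1:R))
  /\
  (* (iii) *)
  ((fun N => t N / (N%:R ^+ 2)) @ \oo --> +oo ->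
     (\forall N \near \oo, RNt N \is a fin_num) /\
     (fun N => fine (RNt N) /
        (alpha * moment2 rho / (delta * kappa) * N%:R ^+ 2)) @ \oo --> (1:R)).
Proof.
move=> k_ge2 ks_ge2 sum_ks alpha_gt0 delta_gt0 _ rho2_gt0 mX [C R0_le] t_y.
move=> kappa RNt; subst k; have rho_sqr := moment2_gt0_integrable rho2_gt0.
have merged_gt0 : (0 < merged_pairs ks)%N by apply: merged_pairs_gt0 => //; lia.
have kappaE : kappa = (merged_pairs ks)%:R by rewrite natr_merged_pairs.
have D_gt0 : 0 < delta * kappa by rewrite kappaE mulr_gt0 ?ltr0n.
have a_gt0 : 0 < alpha * moment2 rho by exact: mulr_gt0.
have theta_gt0 : \forall N \near \oo, 0 < relax_rate delta ks N.
  by exists 2%N => // N /= N2; exact: relax_rate_gt0.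
have theta_sqr : (fun N => relax_rate delta ks N * N%:R ^+ 2) @ \oo -->
    delta * kappa by rewrite kappaE; exact: cvg_relax_rate_sqr.
have sqr_y := @cvg_sqr_natr R; have R0_near := near_RN0_le R0_le.
have RN_relaxed :=
  near_RN_relax rho_sqr (ltW alpha_gt0) delta_gt0 merged_gt0 mX R0_le t_y.
split=> [t_sqr|]; last split=> [c c_gt0 tE|t_sqr];
  apply: cvg_fine_div RN_relaxed _.
- exact: (cvg_relax_short a_gt0 theta_gt0 R0_near t_y sqr_y theta_sqr t_sqr).
- have t_sqr : (fun N => t N / N%:R ^+ 2) @ \oo --> c.
    apply: cvg_near_cst; exists 1%N => // N /= N1.
    by rewrite tE mulfK // expf_neq0 // pnatr_eq0 -lt0n.
  exact: (cvg_relax_moderate a_gt0 D_gt0 theta_gt0 R0_near t_y sqr_y theta_sqr).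
- exact: (cvg_relax_equilibrium a_gt0 D_gt0 theta_gt0 R0_near t_y sqr_y
    theta_sqr).
Qed.
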